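(* $(\mathfrak g_4,S_A,J)$ is not a second kind algebraic Ricci soliton associated to $\nabla^1$: there do not exist $c\in\mathbb R$ and a derivation $D$ of $\mathfrak g_4$ such that $\widetilde{\operatorname{Ric}}^1=c\operatorname{Id}+D$.
   Context: $\mathfrak g_4$ is the real Lie algebra with basis $e_1,e_2,e_3,e_4$ and non-zero brackets (up to skew-symmetry) $[e_1,e_2]=e_3$, $[e_1,e_3]=e_4$. $S_A$ is the Lorentzian inner product $\langle\cdot,\cdot\rangle$ on $\mathfrak g_4$ whose matrix in $(e_1,e_2,e_3,e_4)$ is $\begin{bmatrix}1&0&0&0\\0&1&0&0\\0&0&a&b\\0&0&b&c_0\end{bmatrix}$, where $A=\begin{bmatrix}a&b\\ b&c_0\end{bmatrix}$ is an arbitrary real symmetric matrix of Lorentzian signature ($\det A<0$). Fix (arbitrary) real numbers $\alpha,\beta,\mu,\nu$ such that $v_1=e_1$, $v_2=e_2$, $v_3=\alpha e_3+\beta e_4$, $v_4=\mu e_3+\nu e_4$ is an orthonormal basis for $S_A$: $\langle v_i,v_j\rangle=0$ for $i\ne j$, $\langle v_i,v_i\rangle=1$ for $i=1,2,3$, $\langle v_4,v_4\rangle=-1$. The product structure $J$ is the linear map with $Jv_i=v_i$ for $i=1,2,3$ and $Jv_4=-v_4$. Write $\mathfrak g$ for the Lie algebra. The Levi-Civita connection is the bilinear map $\nabla:\mathfrak g\times\mathfrak g\to\mathfrak g$ with $2\langle\nabla_uv,w\rangle=\langle[u,v],w\rangle+\langle[w,u],v\rangle+\langle[w,v],u\rangle$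 for all $u,v,w$. Put $(\nabla_uJ)v=\nabla_u(Jv)-J(\nabla_uv)$. The canonical connection is $\nabla^0_uv=\nabla_uv-\frac12(\nabla_uJ)Jv$, and the Kobayashi-Nomizu connection is $\nabla^1_uv=\nabla^0_uv-\frac14\left[(\nabla_vJ)Ju-(\nabla_{Jv}J)u\right]$. The curvature of $\nabla^1$ is $R^1_{uv}w=\nabla^1_{[u,v]}w-\nabla^1_u\nabla^1_vw+\nabla^1_v\nabla^1_uw$, its Ricci operator is $\operatorname{Ric}^1(u)=\sum_{k=1}^4\langle v_k,v_k\rangle R^1_{v_ku}v_k$, and $\rho^1(u,v)=\langle\operatorname{Ric}^1(u),v\rangle$. Put $\widetilde\rho^1(u,v)=\frac12(\rho^1(u,v)+\rho^1(v,u))$ and define $\widetilde{\operatorname{Ric}}^1$ by $\langle\widetilde{\operatorname{Ric}}^1(u),v\rangle=\widetilde\rho^1(u,v)$. A derivation of $\mathfrak g$ is a linear map $D:\mathfrak g\to\mathfrak g$ with $[D(u),v]+[u,D(v)]=D[u,v]$ for all $u,v\in\mathfrak g$. *)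

(* Defs.v *)
From mathcomp Require Import all_boot all_order all_algebra.
From mathcomp Require Import reals.
From mathcomp Require Import ring.

Set Implicit Arguments.
Unset Strict Implicit.
Unset Printing Implicit Defensive.

Import Order.TTheory GRing.Theory Num.Theory.
Local Open Scope ring_scope.

Section LeftInvariantGeometry.
Variables (R : realType) (V : lmodType R).
Implicit Types (br nabla : V -> V -> V) (ip : V -> V -> R) (J : V -> V).
Implicit Types (u v w : V).

Definition is_bilinear (f : V -> V -> V) : Prop :=
  (forall u, linear (f u)) /\ (forall v, linear (f^~ v)).

Definition is_lie_bracket br : Prop :=
  [/\ is_bilinear br, forall u, br u u = 0
    & forall u v w, br u (br v w) + br v (br w u) + br w (br u v) = 0].

Definition is_derivation br (D : V -> V) : Prop :=
  forall u v, br (D u) v + br u (D v) = D (br u v).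

Definition is_levi_civita br ip nabla : Prop :=
  is_bilinear nabla /\
  forall u v w,
    2 * ip (nabla u v) w = ip (br u v) w + ip (br w u) v + ip (br w v) u.

(* (nabla_u J) v *)
Definition cov_deriv nabla J u v : V := nabla u (J v) - J (nabla u v).

Definition canonical_conn nabla J u v : V :=
  nabla u v - 2^-1 *: cov_deriv nabla J u (J v).

Definition kobayashi_nomizu nabla J u v : V :=
  canonical_conn nabla J u v
  - 4^-1 *: (cov_deriv nabla J v (J u) - cov_deriv nabla J (J v) u).

(* The sign convention is R_{uv} = nabla_[u,v] - [nabla_u, nabla_v]. *)
Definition curvature br nabla u v w : V :=
  nabla (br u v) w - nabla u (nabla v w) + nabla v (nabla u w).

Definition ricci_op br ip nabla n (e : 'I_n -> V) u : V :=
  \sum_(k < n) ip (e k) (e k) *: curvature br nabla (e k) u (e k).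

Definition ricci_form br ip nabla n (e : 'I_n -> V) u v : R :=
  ip (ricci_op br ip nabla e u) v.

Definition sym_ricci_form br ip nabla n (e : 'I_n -> V) u v : R :=
  2^-1 * (ricci_form br ip nabla e u v + ricci_form br ip nabla e v u).

(* [T] is the symmetrised Ricci operator; for a nondegenerate [ip] there is
   exactly one such [T]. *)
Definition is_sym_ricci_op br ip nabla n (e : 'I_n -> V) (T : V -> V) : Prop :=
  forall u v, ip (T u) v = sym_ricci_form br ip nabla e u v.

End LeftInvariantGeometry.

(* Indices are shifted by one: the basis vector e_(i+1) is [evec i]. *)
Definition evec (R : realType) (i : 'I_4) : 'rV[R]_4 := delta_mx 0 i.

Definition e1 {R : realType} : 'rV[R]_4 := evec R (inord 0).
Definition e2 {R : realType} : 'rV[R]_4 := evec R (inord 1).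
Definition e3 {R : realType} : 'rV[R]_4 := evec R (inord 2).
Definition e4 {R : realType} : 'rV[R]_4 := evec R (inord 3).

(* The bilinear alternating extension of [e1, e2] = e3, [e1, e3] = e4. *)
Definition g4_bracket (R : realType) (x y : 'rV[R]_4) : 'rV[R]_4 :=
  let x_ i := x 0 (inord i) in let y_ i := y 0 (inord i) in
  (x_ 0 * y_ 1 - x_ 1 * y_ 0) *: e3 + (x_ 0 * y_ 2 - x_ 2 * y_ 0) *: e4.

Definition S_A (R : realType) (A : 'M[R]_2) : 'M[R]_4 :=
  block_mx (1%:M : 'M_2) 0 0 A.

Definition inner (R : realType) n (G : 'M[R]_n) (x y : 'rV[R]_n) : R :=
  (x *m G *m y^T) 0 0.

Definition frame (R : realType) (alpha beta mu nu : R) : 'I_4 -> 'rV[R]_4 :=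
  tnth [tuple e1; e2; alpha *: e3 + beta *: e4; mu *: e3 + nu *: e4].

Definition eps (R : realType) (i : 'I_4) : R := if i == ord_max then -1 else 1.

Definition is_orthonormal (R : realType) (G : 'M[R]_4) (v : 'I_4 -> 'rV[R]_4)
    : Prop :=
  forall i j, inner G (v i) (v j) = if i == j then eps R i else 0.

Lemma evecE (R : realType) (i j : nat) : (i < 4)%N -> (j < 4)%N ->
  evec R (inord i) 0 (inord j) = (i == j)%:R.
Proof.
by move=> hi hj; rewrite mxE eqxx /= -val_eqE /= !inordK // eq_sym.
Qed.

Lemma g4_bracketE (R : realType) :
  [/\ g4_bracket e1 e2 = e3 :> 'rV[R]_4, g4_bracket e1 e3 = e4 :> 'rV[R]_4,
      g4_bracket e1 e4 = 0 :> 'rV[R]_4, g4_bracket e2 e3 = 0 :> 'rV[R]_4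
    & g4_bracket e2 e4 = 0 :> 'rV[R]_4 /\ g4_bracket e3 e4 = 0 :> 'rV[R]_4].
Proof.
by split; [| | | |split]; rewrite /g4_bracket /e1 /e2 /e3 /e4 !evecE //=
  ?(mulr1, mulr0, mul0r, subr0, oppr0, scale0r, scale1r, addr0, add0r).
Qed.

Lemma g4_bracket_lie (R : realType) : is_lie_bracket (@g4_bracket R).
Proof.
split=> [|u|u v w].
- by split=> x a y z; apply/rowP=> i; rewrite !mxE; ring.
- by apply/rowP=> i; rewrite !mxE; ring.
- apply/rowP=> i; rewrite /g4_bracket !mxE !eqxx /= -!val_eqE /= !inordK //=.
  by ring.
Qed.

Lemma S_A_unit (R : realType) (A : 'M[R]_2) : \det A < 0 -> S_A A \in unitmx.
Proof.
move=> hA; rewrite unitmxE /S_A (@det_ublock R 2 2) det1 mul1r unitfE.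
by rewrite lt_eqF.
Qed.

Lemma inner_inj (R : realType) n (G : 'M[R]_n) (x y : 'rV[R]_n) :
  G \in unitmx -> (forall w, inner G x w = inner G y w) -> x = y.
Proof.
move=> hG h; apply: (can_inj (mulmxK hG)); apply/rowP=> i.
have := h (delta_mx 0 i); rewrite /inner !trmx_delta -!colE.
by rewrite !mxE.
Qed.

Lemma inner_repr (R : realType) n (G : 'M[R]_n) (f : 'rV[R]_n -> R) :
  G \in unitmx -> (forall a x y, f (a *: x + y) = a * f x + f y) ->
  forall w, inner G ((\row_i f (delta_mx 0 i)) *m invmx G) w = f w.
Proof.
move=> hG hf w; rewrite /inner mulmxKV // mxE {2}(row_sum_delta w).
have f0 : f 0 = 0.
  by have := hf (-1) 0 0; rewrite scaler0 addr0 mulN1r addNr.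
have fD x y : f (x + y) = f x + f y by have := hf 1 x y; rewrite scale1r mul1r.
have fZ a x : f (a *: x) = a * f x.
  by have := hf a x 0; rewrite !addr0 f0 addr0.
rewrite (big_morph f fD f0); apply: eq_bigr => i _.
by rewrite !mxE fZ mulrC.
Qed.

Lemma levi_civita_exists (R : realType) n (G : 'M[R]_n)
    (br : 'rV[R]_n -> 'rV[R]_n -> 'rV[R]_n) :
  G \in unitmx -> is_bilinear br ->
  exists nabla, is_levi_civita br (inner G) nabla.
Proof.
move=> hG [brr brl].
have ipl a x y z : inner G (a *: x + y) z = a * inner G x z + inner G y z.
  by rewrite /inner mulmxDl -scalemxAl mulmxDl -scalemxAl !mxE.
have ipr a x y z : inner G z (a *: x + y) = a * inner G z x + inner G z y.
  by rewrite /inner linearP /= mulmxDr -scalemxAr !mxE.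
have brR z a x y : br z (a *: x + y) = a *: br z x + br z y by exact: brr.
have brL z a x y : br (a *: x + y) z = a *: br x z + br y z by exact: brl.
pose K u v w : R :=
  2^-1 * (inner G (br u v) w + inner G (br w u) v + inner G (br w v) u).
have Kw u v : forall a x y, K u v (a *: x + y) = a * K u v x + K u v y.
  by move=> a x y; rewrite /K !(brR, brL, ipl, ipr); ring.
exists (fun u v => (\row_i K u v (delta_mx 0 i)) *m invmx G).
split; last first.
  move=> u v w; rewrite (inner_repr hG (Kw u v)) /K.
  by rewrite mulrA divff ?mul1r // pnatr_eq0.
split=> z a x y.
  rewrite scalemxAl -mulmxDl; congr (_ *m _); apply/rowP=> i; rewrite !mxE /K.
  by rewrite !(brR, brL, ipl, ipr); ring.
rewrite scalemxAl -mulmxDl; congr (_ *m _); apply/rowP=> i; rewrite !mxE /K.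
by rewrite !(brR, brL, ipl, ipr); ring.
Qed.

Lemma levi_civita_unique (R : realType) n (G : 'M[R]_n)
    (br nabla nabla' : 'rV[R]_n -> 'rV[R]_n -> 'rV[R]_n) :
  G \in unitmx -> is_levi_civita br (inner G) nabla ->
  is_levi_civita br (inner G) nabla' -> nabla =2 nabla'.
Proof.
move=> hG [_ h] [_ h'] u v; apply: (inner_inj hG) => w.
by apply: (@mulfI _ 2); rewrite ?pnatr_eq0 // h h'.
Qed.

(* Main.v *)
(** In the frame [v] the brackets are [[v1, v2] = p v3 + q v4],
    [[v1, v3] = a v3 + b v4] and [[v1, v4] = c v3 - a v4], so the symmetrised
    Ricci operator [T] is an explicit matrix. A derivation
    [D = T - l] preserves the derived algebra [span(v3, v4)], so the entries of
    [T] from [v3] and [v4] to [v2] vanish: [p c = 0] and [q c + 2 p a = 0].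
    Independence of [e3 = [v1, v2]] and [e4 = [v1, e3]] reads
    [b p^2 - 2 a p q - c q^2 <> 0], which leaves only [a = c = 0] and
    [p, b <> 0]. Then the derivation rule on [[v1, v3]] forces [l = 0], and on
    [[v1, v2]] it forces [l = - 3/2 p^2], a contradiction. *)
Require Import Defs.
From mathcomp Require Import all_boot all_order all_algebra.
From mathcomp Require Import reals.
From mathcomp Require Import ring lra.
Set Implicit Arguments.
Unset Strict Implicit.
Unset Printing Implicit Defensive.
Import Order.TTheory GRing.Theory Num.Theory.
Local Open Scope ring_scope.

(** * Coordinates relative to a family of four vectors *)

Section Comb4.
Variables (R : realType) (V : lmodType R) (v : 'I_4 -> V).

(** Four separate scalars instead of a row vector: [congr comb4] then leaves scalar identities for
    [field]. *)
Definition comb4 (x1 x2 x3 x4 : R) : V :=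
  x1 *: v (inord 0) + x2 *: v (inord 1) + x3 *: v (inord 2) + x4 *: v (inord 3).

Lemma comb4D x1 x2 x3 x4 y1 y2 y3 y4 :
  comb4 x1 x2 x3 x4 + comb4 y1 y2 y3 y4
  = comb4 (x1 + y1) (x2 + y2) (x3 + y3) (x4 + y4).
Proof.
rewrite /comb4 !scalerDl addrACA; congr (_ + _).
by rewrite addrACA; congr (_ + _); rewrite addrACA.
Qed.

Lemma comb4Z k x1 x2 x3 x4 :
  k *: comb4 x1 x2 x3 x4 = comb4 (k * x1) (k * x2) (k * x3) (k * x4).
Proof. by rewrite /comb4 !scalerDr !scalerA. Qed.

Lemma comb4N x1 x2 x3 x4 :
  - comb4 x1 x2 x3 x4 = comb4 (- x1) (- x2) (- x3) (- x4).
Proof. by rewrite -scaleN1r comb4Z !mulN1r. Qed.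

Lemma frame_comb4 k : v k = comb4 (k == 0 :> nat)%:R (k == 1 :> nat)%:R
                                  (k == 2 :> nat)%:R (k == 3 :> nat)%:R.
Proof.
rewrite /comb4; case: k => [[|[|[|[|//]]]] hk] /=;
  rewrite ?scale0r ?scale1r ?add0r ?addr0; congr v; apply/val_inj;
  by rewrite /= inordK.
Qed.

Definition comb4E := (comb4D, comb4Z, comb4N).

End Comb4.

(** * Curvature and derivations from the structure constants of an orthonormal frame *)

Section OrthonormalFrame.
Variables (R : realType) (V : lmodType R) (v : 'I_4 -> V).
Variables (br : V -> V -> V) (ip : V -> V -> R) (J : V -> V).
Variables (p q a b c : R).
Local Notation cb := (comb4 v).

Hypothesis v_span : forall u, exists x1 x2 x3 x4, u = cb x1 x2 x3 x4.
Hypothesis brE : forall x1 x2 x3 x4 y1 y2 y3 y4,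
  br (cb x1 x2 x3 x4) (cb y1 y2 y3 y4) =
  cb 0 0 (p * (x1 * y2 - x2 * y1) + a * (x1 * y3 - x3 * y1)
          + c * (x1 * y4 - x4 * y1))
         (q * (x1 * y2 - x2 * y1) + b * (x1 * y3 - x3 * y1)
          - a * (x1 * y4 - x4 * y1)).
Hypothesis ipE : forall x1 x2 x3 x4 y1 y2 y3 y4,
  ip (cb x1 x2 x3 x4) (cb y1 y2 y3 y4) = x1 * y1 + x2 * y2 + x3 * y3 - x4 * y4.
Hypothesis JE : forall x1 x2 x3 x4, J (cb x1 x2 x3 x4) = cb x1 x2 x3 (- x4).

Lemma comb4_inj x1 x2 x3 x4 y1 y2 y3 y4 :
  cb x1 x2 x3 x4 = cb y1 y2 y3 y4 -> [/\ x1 = y1, x2 = y2, x3 = y3 & x4 = y4].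
Proof.
move=> h; have e z1 z2 z3 z4 := congr1 (ip^~ (cb z1 z2 z3 z4)) h.
(* The last test vector carries [-1] because [v4] has square [-1]. *)
move: (e 1 0 0 0) (e 0 1 0 0) (e 0 0 1 0) (e 0 0 0 (-1)); rewrite /= !ipE.
by rewrite !(mulr0, mulr1, mulrN1, subr0, addr0, add0r, opprK).
Qed.

Lemma eq_comb4 u x1 x2 x3 x4 :
  ip u (cb 1 0 0 0) = x1 -> ip u (cb 0 1 0 0) = x2 ->
  ip u (cb 0 0 1 0) = x3 -> ip u (cb 0 0 0 1) = - x4 -> u = cb x1 x2 x3 x4.
Proof.
have [y1 [y2 [y3 [y4 ->]]]] := v_span u; rewrite !ipE.
rewrite !(mulr0, mulr1, subr0, addr0, add0r, sub0r) => -> -> ->.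
by move/oppr_inj ->.
Qed.

Variable nabla : V -> V -> V.
Hypothesis nabla_LC : is_levi_civita br ip nabla.

(** The Koszul formula tested on each frame vector, with the sign reversed for the timelike one. *)
Lemma levi_civita_comb4 x1 x2 x3 x4 y1 y2 y3 y4 :
  nabla (cb x1 x2 x3 x4) (cb y1 y2 y3 y4) =
  cb (2^-1 * ((p * x2 + a * x3 + c * x4) * y3 - (q * x2 + b * x3 - a * x4) * y4
      + (p * y2 + a * y3 + c * y4) * x3 - (q * y2 + b * y3 - a * y4) * x4))
     (2^-1 * (q * (x1 * y4 + x4 * y1) - p * (x1 * y3 + x3 * y1)))
     (2^-1 * (p * (x1 * y2 - x2 * y1) + a * (x1 * y3 - x3 * y1)
          + c * (x1 * y4 - x4 * y1)
          - a * (x1 * y3 + x3 * y1) + b * (x1 * y4 + x4 * y1)))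
     (2^-1 * (q * (x1 * y2 - x2 * y1) + b * (x1 * y3 - x3 * y1)
          - a * (x1 * y4 - x4 * y1)
          + c * (x1 * y3 + x3 * y1) + a * (x1 * y4 + x4 * y1))).
Proof.
case: nabla_LC => _ h.
by apply: eq_comb4; apply: (@mulfI _ 2); rewrite ?pnatr_eq0 //
  h !brE !ipE; field.
Qed.

(** This connection commutes with [J]: the first three coordinates involve only [y1], [y2], [y3],
    and the last only [y4]. *)
Lemma kobayashi_nomizu_comb4 x1 x2 x3 x4 y1 y2 y3 y4 :
  kobayashi_nomizu nabla J (cb x1 x2 x3 x4) (cb y1 y2 y3 y4) =
  cb (2^-1 * p * (x2 * y3 + x3 * y2) + a * x3 * y3)
     (- (2^-1 * p * (x1 * y3 + x3 * y1)))
     (2^-1 * p * (x1 * y2 - x2 * y1) - (a * x3 + c * x4) * y1)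
     (- (a * x1 * y4)).
Proof.
rewrite /kobayashi_nomizu /canonical_conn /cov_deriv.
rewrite !(JE, levi_civita_comb4) !comb4E.
by congr comb4; field.
Qed.

(** The last coordinate vanishes: the connection preserves the span of [v1], [v2], [v3], and on the
    line of [v4] it is the form [- a * x1], which kills brackets, so that line is flat. *)
Lemma ricci_op_comb4 x1 x2 x3 x4 :
  ricci_op br ip (kobayashi_nomizu nabla J) v (cb x1 x2 x3 x4) =
  cb (- (a ^+ 2 + 2^-1 * p ^+ 2) * x1)
     (- (2^-1 * p ^+ 2 * x2 + p * a * x3 + p * c * x4))
     ((2^-1 * p ^+ 2 - a ^+ 2 - b * c) * x3 - (q * c + p * a) * x2
      - a * c * x4)
     0.
Proof.
rewrite /ricci_op /curvature !big_ord_recl big_ord0 !frame_comb4 /=.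
rewrite !(ipE, brE, kobayashi_nomizu_comb4) !comb4E addr0 !comb4E.
by congr comb4; field.
Qed.

Lemma sym_ricci_form_comb4 x1 x2 x3 x4 y1 y2 y3 y4 :
  sym_ricci_form br ip (kobayashi_nomizu nabla J) v
    (cb x1 x2 x3 x4) (cb y1 y2 y3 y4) =
  - (a ^+ 2 + 2^-1 * p ^+ 2) * x1 * y1 - 2^-1 * p ^+ 2 * x2 * y2
  + (2^-1 * p ^+ 2 - a ^+ 2 - b * c) * x3 * y3
  - (p * a + 2^-1 * q * c) * (x2 * y3 + x3 * y2)
  - 2^-1 * p * c * (x2 * y4 + x4 * y2) - 2^-1 * a * c * (x3 * y4 + x4 * y3).
Proof. by rewrite /sym_ricci_form /ricci_form !ricci_op_comb4 !ipE; field. Qed.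

(* [[v1, v2]] and [[v1, [v1, v2]]] are linearly independent. *)
Hypothesis independent : b * p ^+ 2 - 2 * a * p * q - c * q ^+ 2 != 0.

Lemma not_ricci_soliton (Ric : V -> V) (l : R) (D : {linear V -> V}) :
  is_sym_ricci_op br ip (kobayashi_nomizu nabla J) v Ric ->
  is_derivation br D -> ~ (forall u, Ric u = l *: u + D u).
Proof.
move=> RicE derD RicD.
(* [ip] is known only through [ipE], so its linearity is recovered in coordinates. *)
have ip_sub u w k : ip (w - k *: u) =1 fun z => ip w z - k * ip u z.
  have [x1 [x2 [x3 [x4 ->]]]] := v_span u.
  have [y1 [y2 [y3 [y4 ->]]]] := v_span w.
  move=> z; have [z1 [z2 [z3 [z4 ->]]]] := v_span z.
  by rewrite !comb4E !ipE; ring.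
have DE x1 x2 x3 x4 : D (cb x1 x2 x3 x4) =
    cb (- (a ^+ 2 + 2^-1 * p ^+ 2) * x1 - l * x1)
     (- (2^-1 * p ^+ 2 * x2) - (p * a + 2^-1 * q * c) * x3
      - 2^-1 * p * c * x4 - l * x2)
     ((2^-1 * p ^+ 2 - a ^+ 2 - b * c) * x3 - (p * a + 2^-1 * q * c) * x2
      - 2^-1 * a * c * x4 - l * x3)
     (2^-1 * p * c * x2 + 2^-1 * a * c * x3 - l * x4).
  have -> : D (cb x1 x2 x3 x4) = Ric (cb x1 x2 x3 x4) - l *: cb x1 x2 x3 x4.
    by rewrite RicD addrAC subrr add0r.
  by apply: eq_comb4; rewrite ip_sub RicE sym_ricci_form_comb4 ipE; ring.
have := derD (cb 1 0 0 0) (cb 0 1 0 0).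
rewrite !(brE, DE) comb4E => /comb4_inj[_ E12_2 E12_3 _].
have := derD (cb 1 0 0 0) (cb 0 0 1 0).
rewrite !(brE, DE) comb4E => /comb4_inj[_ E13_2 _ E13_4].
have := derD (cb 1 0 0 0) (cb 0 0 0 1).
rewrite !(brE, DE) comb4E => /comb4_inj[_ E14_2 _ _].
(* [- t3] and [- t4] are the [v2] coordinates of [D v3] and [D v4]. Brackets have no [v2]
   coordinate, so the functional [(t3, t4)] vanishes on every [[v1, vi]]. *)
set t3 := p * a + 2^-1 * q * c in E12_2 E13_2 E14_2.
set t4 := 2^-1 * p * c in E12_2 E13_2 E14_2.
have e12 : p * t3 + q * t4 = 0 by lra.
have e13 : a * t3 + b * t4 = 0 by lra.
have e14 : c * t3 - a * t4 = 0 by lra.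
have t30 : t3 = 0.
  (* Cramer's rule for the values of the functional on [[v1, v2]] and [[v1, [v1, v2]]]; the
     determinant is the one in [independent]. *)
  apply: (mulfI independent); rewrite mulr0.
  transitivity ((b * p - a * q) * (p * t3 + q * t4)
    - q * (p * (a * t3 + b * t4) + q * (c * t3 - a * t4))); first by ring.
  by rewrite e12 e13 e14; ring.
have t40 : t4 = 0.
  apply: (mulfI independent); rewrite mulr0.
  transitivity (p * (p * (a * t3 + b * t4) + q * (c * t3 - a * t4))
    - (a * p + c * q) * (p * t3 + q * t4)); first by ring.
  by rewrite e12 e13 e14; ring.
have p_neq0 : p != 0.
  (* At [p = 0] the determinant is [- c * q ^+ 2], a multiple of [t3 = 2^-1 * q * c]. *)
  apply: contraNneq independent => p0; move: t30; rewrite /t3 p0 => cq.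
  have -> : b * 0 ^+ 2 - 2 * a * 0 * q - c * q ^+ 2
            = - (2 * q) * (0 * a + 2^-1 * q * c) by field.
  by rewrite cq mulr0.
have c0 : c = 0 by apply: (mulfI p_neq0); move: t40; rewrite /t4; lra.
have a0 : a = 0.
  by apply: (mulfI p_neq0); move: t30; rewrite /t3 c0; lra.
move: independent; rewrite a0 c0 !(mulr0, mul0r) !subr0 => bp.
have b_neq0 : b != 0 by apply: contraNneq bp => ->; rewrite mul0r.
(* [D] is now diagonal with entries [- p^2/2 - l], [- p^2/2 - l], [p^2/2 - l], [- l]. Along
   [[v1, v3] = b v4] the entries of [v1] and [v3] add up to that of [v4]; along the [v3] part of
   [[v1, v2]] those of [v1] and [v2] add up to that of [v3]. *)
have l0 : l = 0.
  by apply: (mulfI b_neq0); move: E13_4; rewrite /t3 /t4 a0 c0; lra.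
have p20 : p * p ^+ 2 = 0.
  by move: E12_3; rewrite a0 c0 l0; lra.
by move/eqP: p20; rewrite mulf_eq0 expf_eq0 /= (negPf p_neq0).
Qed.

End OrthonormalFrame.

(** * The Lie algebra [g4] in the given frame *)

Lemma inner_linearl (R : realType) n (G : 'M[R]_n) k x y z :
  inner G (k *: x + y) z = k * inner G x z + inner G y z.
Proof. by rewrite /inner mulmxDl -scalemxAl mulmxDl -scalemxAl !mxE. Qed.

Lemma inner_linearr (R : realType) n (G : 'M[R]_n) k x y z :
  inner G z (k *: x + y) = k * inner G z x + inner G z y.
Proof. by rewrite /inner linearP /= mulmxDr -scalemxAr !mxE. Qed.

Section FrameG4.
Variables (R : realType) (alpha beta mu nu : R).
Local Notation v := (frame alpha beta mu nu).
Local Notation cb := (comb4 v).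

Lemma frameE : [/\ v (inord 0) = e1, v (inord 1) = e2,
  v (inord 2) = alpha *: e3 + beta *: e4
  & v (inord 3) = mu *: e3 + nu *: e4].
Proof. by rewrite /frame !(tnth_nth 0) !inordK. Qed.

Lemma comb4_coord x1 x2 x3 x4 : cb x1 x2 x3 x4 =
  x1 *: e1 + x2 *: e2 + (x3 * alpha + x4 * mu) *: e3
  + (x3 * beta + x4 * nu) *: e4.
Proof.
rewrite /comb4; case: frameE => -> -> -> ->.
by apply/rowP=> i; rewrite !mxE; ring.
Qed.

Lemma inner_comb4 (G : 'M[R]_4) : is_orthonormal G v ->
  forall x1 x2 x3 x4 y1 y2 y3 y4,
  inner G (cb x1 x2 x3 x4) (cb y1 y2 y3 y4)
  = x1 * y1 + x2 * y2 + x3 * y3 - x4 * y4.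
Proof.
move=> orth x1 x2 x3 x4 y1 y2 y3 y4; rewrite /comb4.
(* Right-nested sums ending in [0] match the shape [k *: x + y] of the linearity lemmas. *)
rewrite -!addrA -[x4 *: _]addr0 -[y4 *: _]addr0.
have inner0l z : inner G 0 z = 0 by rewrite /inner !mul0mx mxE.
have inner0r z : inner G z 0 = 0 by rewrite /inner linear0 mulmx0 mxE.
rewrite !(inner_linearl, inner_linearr) !(inner0l, inner0r) !orth.
rewrite /eps -!val_eqE /= !inordK //=; ring.
Qed.

(** If the determinant were zero, [(nu, - beta)] and [(- mu, alpha)] would be relations between [v3]
    and [v4], hence trivial; then [v3 = 0], which is absurd. *)
Lemma frame_det_neq0 (G : 'M[R]_4) :
  is_orthonormal G v -> alpha * nu - beta * mu != 0.
Proof.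
move=> orth; have ipE := inner_comb4 orth.
apply/eqP=> d0.
have z34 x3 x4 : x3 * alpha + x4 * mu = 0 -> x3 * beta + x4 * nu = 0 ->
    x3 = 0 /\ x4 = 0.
  move=> h1 h2.
  suff /(comb4_inj ipE)[_ _ -> ->] : cb 0 0 x3 x4 = cb 0 0 0 0 by [].
  by rewrite !comb4_coord h1 h2 !mul0r addr0.
have [nu0 /eqP] : nu = 0 /\ - beta = 0 by apply: z34; [rewrite -d0 | ]; ring.
rewrite oppr_eq0 => /eqP beta0.
have [_ alpha0] : - mu = 0 /\ alpha = 0.
  by apply: z34; [| rewrite -d0]; ring.
have [/eqP] : (1 : R) = 0 /\ (0 : R) = 0.
  by apply: z34; rewrite ?alpha0 ?beta0; ring.
by rewrite oner_eq0.
Qed.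

Hypothesis d_neq0 : alpha * nu - beta * mu != 0.
Local Notation d := (alpha * nu - beta * mu).

Lemma frame_span u : exists x1 x2 x3 x4, u = cb x1 x2 x3 x4.
Proof.
(* The last two coordinates solve a 2 by 2 system by Cramer's rule. *)
exists (u 0 (inord 0)), (u 0 (inord 1)),
  ((u 0 (inord 2) * nu - u 0 (inord 3) * mu) / d),
  ((u 0 (inord 3) * alpha - u 0 (inord 2) * beta) / d).
rewrite comb4_coord.
have -> : (u 0 (inord 2) * nu - u 0 (inord 3) * mu) / d * alpha
  + (u 0 (inord 3) * alpha - u 0 (inord 2) * beta) / d * mu = u 0 (inord 2).
  by field.
have -> : (u 0 (inord 2) * nu - u 0 (inord 3) * mu) / d * beta
  + (u 0 (inord 3) * alpha - u 0 (inord 2) * beta) / d * nu = u 0 (inord 3).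
  by field.
rewrite {1}[u]row_sum_delta !big_ord_recl big_ord0 addr0 !addrA.
by congr (_ + _ + _ + _); congr (u 0 _ *: delta_mx 0 _); apply/val_inj;
  rewrite /= inordK.
Qed.

(** The constants come from [e3 = (nu v3 - beta v4) / d] and [e4 = (alpha v4 - mu v3) / d], with
    [[v1, v2] = e3], [[v1, v3] = alpha e4] and [[v1, v4] = mu e4]. *)
Lemma g4_bracket_comb4 x1 x2 x3 x4 y1 y2 y3 y4 :
  let p := nu / d in let q := - beta / d in
  let a := - (alpha * mu) / d in let b := alpha ^+ 2 / d in
  let c := - (mu ^+ 2) / d in
  g4_bracket (cb x1 x2 x3 x4) (cb y1 y2 y3 y4) =
  cb 0 0 (p * (x1 * y2 - x2 * y1) + a * (x1 * y3 - x3 * y1)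
          + c * (x1 * y4 - x4 * y1))
         (q * (x1 * y2 - x2 * y1) + b * (x1 * y3 - x3 * y1)
          - a * (x1 * y4 - x4 * y1)).
Proof.
move=> /=; rewrite !comb4_coord !scale0r !add0r.
rewrite /g4_bracket !mxE !eqxx /= -!val_eqE /= !inordK //=.
by congr (_ *: _ + _ *: _); field.
Qed.

End FrameG4.

Theorem theorem3p28 (R : realType) (A : 'M[R]_2)
    (A_sym : A^T = A) (A_lorentz : \det A < 0)
    (alpha beta mu nu : R)
    (v_orthonormal : is_orthonormal (S_A A) (frame alpha beta mu nu))
    (J : {linear 'rV[R]_4 -> 'rV[R]_4})
    (JE : forall i, J (frame alpha beta mu nu i)
                    = eps R i *: frame alpha beta mu nu i)
    (nabla : 'rV[R]_4 -> 'rV[R]_4 -> 'rV[R]_4)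
    (nabla_LC : is_levi_civita (@g4_bracket R) (inner (S_A A)) nabla)
    (Ric : 'rV[R]_4 -> 'rV[R]_4)
    (RicE : is_sym_ricci_op (@g4_bracket R) (inner (S_A A))
              (kobayashi_nomizu nabla J) (frame alpha beta mu nu) Ric) :
  ~ exists (c : R) (D : {linear 'rV[R]_4 -> 'rV[R]_4}),
      is_derivation (@g4_bracket R) D /\ forall u, Ric u = c *: u + D u.
Proof.
have d0 := frame_det_neq0 v_orthonormal.
have JcE x1 x2 x3 x4 : J (comb4 (frame alpha beta mu nu) x1 x2 x3 x4)
    = comb4 (frame alpha beta mu nu) x1 x2 x3 (- x4).
  rewrite /comb4 !linearD !linearZ /= !JE /eps -!val_eqE /= !inordK //=.
  by rewrite !scale1r scaleN1r scalerN scaleNr.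
case=> l [D [derD RicD]]; apply: not_ricci_soliton RicE derD RicD.
- exact: frame_span d0.
- exact: g4_bracket_comb4 d0.
- exact: inner_comb4 v_orthonormal.
- exact: JcE.
- exact: nabla_LC.
(* This is the determinant of [e3], [e4] relative to [v3], [v4], the inverse of that of [v3], [v4]
   relative to [e3], [e4]. *)
- set h := (X in X != 0).
  suff -> : h = (alpha * nu - beta * mu)^-1 by rewrite invr_eq0.
  by rewrite /h; field.
Qed.
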